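(* Let $\mathbb{K}$ be a field and let $\Omega$ be a set with four binary operations $\leftarrow,\rightarrow,\triangleleft,\triangleright:\Omega\times\Omega\to\Omega$. Define bilinear products $\prec_\alpha,\succ_\alpha$ ($\alpha\in\Omega$) on the vector space $\mathbb{K}\mathcal{T}_\Omega^+$ with basis the nontrivial $\Omega$-typed plane binary trees by the following recursive formulas. For all $T\in\mathcal{T}^+_\Omega$, $T_1,T_2\in\mathcal{T}_\Omega$ and all types: $$\left(T_1\bigvee_{\alpha,\emptyset}|\right)\prec_\gamma T=T_1\bigvee_{\alpha,\gamma}T,$$ $$\left(T_1\bigvee_{\alpha,\beta}T_2\right)\prec_\gamma T=T_1\bigvee_{\alpha,\beta\leftarrow\gamma}(T_2\prec_{\beta\triangleleft\gamma}T)+T_1\bigvee_{\alpha,\beta\rightarrow\gamma}(T_2\succ_{\beta\triangleright\gamma}T)\quad\text{if }T_2\neq |,$$ $$T\succ_\alpha\left(|\bigvee_{\emptyset,\gamma}T_2\right)=T\bigvee_{\alpha,\gamma}T_2,$$ $$T\succ_\alpha\left(T_1\bigvee_{\beta,\gamma}T_2\right)=(T\succ_{\alpha\triangleright\beta}T_1)\bigvee_{\alpha\rightarrow\beta,\gamma}T_2+(T\prec_{\alpha\triangleleft\beta}T_1)\bigvee_{\alpha\leftarrow\beta,\gamma}T_2\quad\text{if }T_1\neq |.$$ Then the following conditions are equivalent: 1. With these products, $\mathbb{K}\mathcal{T}_\Omega^+$ is the free $\Omega$-dendriform algebra freely generated by the tree $Y$ with exactly one internal vertex. 2. With these products, $\mathbb{K}\mathcal{T}_\Omega^+$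 is an $\Omega$-dendriform algebra. 3. $(\Omega,\leftarrow,\rightarrow,\triangleleft,\triangleright)$ is an extended diassociative semigroup (EDS).
   Context: Extended diassociative semigroups. A diassociative semigroup is a set $\Omega$ with maps $\leftarrow,\rightarrow:\Omega\times\Omega\to\Omega$ such that for all $\alpha,\beta,\gamma\in\Omega$: $(\alpha\leftarrow\beta)\leftarrow\gamma=\alpha\leftarrow(\beta\leftarrow\gamma)=\alpha\leftarrow(\beta\rightarrow\gamma)$; $(\alpha\rightarrow\beta)\leftarrow\gamma=\alpha\rightarrow(\beta\leftarrow\gamma)$; $(\alpha\rightarrow\beta)\rightarrow\gamma=(\alpha\leftarrow\beta)\rightarrow\gamma=\alpha\rightarrow(\beta\rightarrow\gamma)$. An extended diassociative semigroup (EDS) is $(\Omega,\leftarrow,\rightarrow,\triangleleft,\triangleright)$ such that $(\Omega,\leftarrow,\rightarrow)$ is a diassociative semigroup and for all $\alpha,\beta,\gamma\in\Omega$: $\alpha\triangleright(\beta\leftarrow\gamma)=\alpha\triangleright\beta$; $(\alpha\rightarrow\beta)\triangleleft\gamma=\beta\triangleleft\gamma$; $(\alpha\triangleleft\beta)\leftarrow((\alpha\leftarrow\beta)\triangleleft\gamma)=\alpha\triangleleft(\beta\leftarrow\gamma)$; $(\alpha\triangleleft\beta)\triangleleft((\alpha\leftarrow\beta)\triangleleft\gamma)=\beta\triangleleft\gamma$; $(\alpha\triangleleft\beta)\rightarrow((\alpha\leftarrow\beta)\triangleleft\gamma)=\alpha\triangleleft(\beta\rightarrow\gamma)$; $(\alpha\triangleleft\beta)\triangleright((\alpha\leftarrow\beta)\triangleleft\gamma)=\beta\triangleright\gamma$;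 $(\alpha\triangleright(\beta\rightarrow\gamma))\leftarrow(\beta\triangleright\gamma)=(\alpha\leftarrow\beta)\triangleright\gamma$; $(\alpha\triangleright(\beta\rightarrow\gamma))\triangleleft(\beta\triangleright\gamma)=\alpha\triangleleft\beta$; $(\alpha\triangleright(\beta\rightarrow\gamma))\rightarrow(\beta\triangleright\gamma)=(\alpha\rightarrow\beta)\triangleright\gamma$; $(\alpha\triangleright(\beta\rightarrow\gamma))\triangleright(\beta\triangleright\gamma)=\alpha\triangleright\beta$. $\Omega$-dendriform algebras. For a set $\Omega$ with four operations $\leftarrow,\rightarrow,\triangleleft,\triangleright$, an $\Omega$-dendriform algebra is a $\mathbb{K}$-vector space $A$ with bilinear products $\prec_\alpha,\succ_\alpha$ ($\alpha\in\Omega$) such that for all $x,y,z\in A$, $\alpha,\beta\in\Omega$: $(x\prec_\alpha y)\prec_\beta z=x\prec_{\alpha\leftarrow\beta}(y\prec_{\alpha\triangleleft\beta}z)+x\prec_{\alpha\rightarrow\beta}(y\succ_{\alpha\triangleright\beta}z)$; $x\succ_\alpha(y\prec_\beta z)=(x\succ_\alpha y)\prec_\beta z$; $x\succ_\alpha(y\succ_\beta z)=(x\succ_{\alpha\triangleright\beta}y)\succ_{\alpha\rightarrow\beta}z+(x\prec_{\alpha\triangleleft\beta}y)\succ_{\alpha\leftarrow\beta}z$. Morphisms are linear maps compatible with all $\prec_\alpha,\succ_\alpha$. ''Free, freely generated by $Y$'' means: for any $\Omega$-dendriform algebra $A$ and $a\in A$ there is a unique morphism sending $Y$ to $a$. Typed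 trees. A plane binary tree is a rooted plane tree in which each internal vertex has a left and a right child; $|$ is the trivial tree (no internal vertex, one leaf). An internal edge is an edge between two internal vertices. An $\Omega$-typed plane binary tree is a plane binary tree with a map (the type) from its set of internal edges to $\Omega$. $\mathcal{T}_\Omega$ is the set of these trees and $\mathcal{T}_\Omega^+=\mathcal{T}_\Omega\setminus\{|\}$. For $T_1,T_2\in\mathcal{T}_\Omega$, $T_1\bigvee_{\alpha,\beta}T_2$ is the tree obtained by grafting $T_1$ on the left and $T_2$ on the right of a common root; the edge from the root to the root of $T_1$ (if $T_1\ne|$) has type $\alpha$, and the edge from the root to the root of $T_2$ (if $T_2\neq|$) has type $\beta$. Convention: $\alpha=\emptyset$ (an extra symbol) exactly when $T_1=|$, and $\beta=\emptyset$ exactly when $T_2=|$; otherwise types lie in $\Omega$. With this convention each $T\in\mathcal{T}_\Omega^+$ is uniquely of the form $T_1\bigvee_{\alpha,\beta}T_2$. The operation $\bigvee_{\alpha,\beta}$ is extended bilinearly to linear combinations. *)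

(* Defs.v *)
From HB Require Import structures.
From mathcomp Require Import all_boot all_algebra finmap.
From mathcomp.classical Require Import boolp.
From mathcomp.multinomials Require Import monalg.

Set Implicit Arguments.
Unset Strict Implicit.
Unset Printing Implicit Defensive.

Import GRing.Theory.
Local Open Scope ring_scope.

(* [ptree Omega] is the set of nontrivial Omega-typed plane binary trees. A
   [branch] is a possibly trivial tree together with the type of the edge by
   which it is grafted to the root: [leaf] is the trivial tree |, with the empty
   type, and [edge alpha T] is the nontrivial tree T, hanging from an internal
   edge of type alpha. So [vee (edge alpha T1) (edge beta T2)] is
   T1 \/_{alpha, beta} T2, and a branch carries the empty type exactly when it
   is trivial. *)
Inductive ptree (Omega : Type) : Type :=
  | vee of branch Omega & branch Omega
with branch (Omega : Type) : Type :=
  | leaf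
  | edge of Omega & ptree Omega.

Arguments leaf {Omega}.

Scheme ptree_branch_ind := Induction for ptree Sort Prop
  with branch_ptree_ind := Induction for branch Sort Prop.
Combined Scheme ptree_branch_mutind from ptree_branch_ind, branch_ptree_ind.

(* The tree Y with exactly one internal vertex. *)
Definition treeY {Omega : Type} : ptree Omega := vee leaf leaf.

(* Classical instances: Omega is an arbitrary type. *)
HB.instance Definition _ (Omega : Type) := gen_eqMixin (ptree Omega).
HB.instance Definition _ (Omega : Type) := gen_choiceMixin (ptree Omega).

Section LinearExtension.
Variables (K : fieldType) (T : choiceType) (V : lmodType K).

Definition lext (f : T -> V) (x : {malg K[T]}) : V :=
  \sum_(t <- msupp x) x@_t *: f t.

Definition bilext (f : T -> T -> V) (x y : {malg K[T]}) : V :=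
  \sum_(s <- msupp x) \sum_(t <- msupp y) (x@_s * y@_t) *: f s t.

Lemma lextU (f : T -> V) t : lext f << t >> = f t.
Proof.
by rewrite /lext msuppU oner_eq0 big_seq_fset1 mcoeffUU scale1r.
Qed.

Lemma bilextU (f : T -> T -> V) s t : bilext f << s >> << t >> = f s t.
Proof.
by rewrite /bilext !msuppU oner_eq0 !big_seq_fset1 !mcoeffUU mulr1 scale1r.
Qed.

End LinearExtension.

Section OmegaStructures.
Variables (Omega : Type) (larr rarr ltri rtri : Omega -> Omega -> Omega).

Local Infix "←" := larr (at level 40, left associativity).
Local Infix "→" := rarr (at level 40, left associativity).
Local Infix "◁" := ltri (at level 40, left associativity).
Local Infix "▷" := rtri (at level 40, left associativity).

Record is_diassociative : Prop := {
  dia_ll_l : forall a b c, (a ← b) ← c = a ← (b ← c);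
  dia_ll_r : forall a b c, a ← (b ← c) = a ← (b → c);
  dia_rl : forall a b c, (a → b) ← c = a → (b ← c);
  dia_rr_l : forall a b c, (a → b) → c = (a ← b) → c;
  dia_rr_r : forall a b c, (a ← b) → c = a → (b → c)
}.

Record is_EDS : Prop := {
  eds_diassociative : is_diassociative;
  eds_rtri_larr : forall a b c, a ▷ (b ← c) = a ▷ b;
  eds_rarr_ltri : forall a b c, (a → b) ◁ c = b ◁ c;
  eds_l_larr : forall a b c, (a ◁ b) ← ((a ← b) ◁ c) = a ◁ (b ← c);
  eds_l_ltri : forall a b c, (a ◁ b) ◁ ((a ← b) ◁ c) = b ◁ c;
  eds_l_rarr : forall a b c, (a ◁ b) → ((a ← b) ◁ c) = a ◁ (b → c);
  eds_l_rtri : forall a b c, (a ◁ b) ▷ ((a ← b) ◁ c) = b ▷ c;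
  eds_r_larr : forall a b c, (a ▷ (b → c)) ← (b ▷ c) = (a ← b) ▷ c;
  eds_r_ltri : forall a b c, (a ▷ (b → c)) ◁ (b ▷ c) = a ◁ b;
  eds_r_rarr : forall a b c, (a ▷ (b → c)) → (b ▷ c) = (a → b) ▷ c;
  eds_r_rtri : forall a b c, (a ▷ (b → c)) ▷ (b ▷ c) = a ▷ b
}.

Section Algebras.
Variable K : fieldType.

Section Dendriform.
Variables (A : lmodType K) (prec succ : Omega -> A -> A -> A).

Local Notation "x ≺[ a ] y" := (prec a x y) (at level 40, y at next level).
Local Notation "x ≻[ a ] y" := (succ a x y) (at level 40, y at next level).

Record is_dendriform : Prop := {
  prec_linear_l : forall a y, linear (fun x => x ≺[a] y);
  prec_linear_r : forall a x, linear (fun y => x ≺[a] y);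
  succ_linear_l : forall a y, linear (fun x => x ≻[a] y);
  succ_linear_r : forall a x, linear (fun y => x ≻[a] y);
  dend_prec : forall a b x y z,
    (x ≺[a] y) ≺[b] z =
    x ≺[a ← b] (y ≺[a ◁ b] z) + x ≺[a → b] (y ≻[a ▷ b] z);
  dend_mid : forall a b x y z,
    x ≻[a] (y ≺[b] z) = (x ≻[a] y) ≺[b] z;
  dend_succ : forall a b x y z,
    x ≻[a] (y ≻[b] z) =
    (x ≻[a ▷ b] y) ≻[a → b] z + (x ≺[a ◁ b] y) ≻[a ← b] z
}.

End Dendriform.

Record is_dend_morphism (A B : lmodType K)
    (precA succA : Omega -> A -> A -> A) (precB succB : Omega -> B -> B -> B)
    (f : A -> B) : Prop := {
  dmor_linear : linear f;
  dmor_prec : forall a x y, f (precA a x y) = precB a (f x) (f y);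
  dmor_succ : forall a x y, f (succA a x y) = succB a (f x) (f y)
}.

Definition is_free_dendriform_on (A : lmodType K)
    (prec succ : Omega -> A -> A -> A) (g : A) : Prop :=
  is_dendriform prec succ /\
  forall (B : lmodType K) (precB succB : Omega -> B -> B -> B),
    is_dendriform precB succB ->
    forall b : B, exists! f : A -> B,
      is_dend_morphism prec succ precB succB f /\ f g = b.

Local Notation KT := {malg K[ptree Omega]}.

(* T1 \/_{alpha, beta} T2, extended linearly in T2 (resp. T1); both are only
   applied to combinations of nontrivial trees. *)
Definition vee_linr (l : branch Omega) (b : Omega) (x : KT) : KT :=
  lext (fun T => << vee l (edge b T) >>) x.
Definition vee_linl (a : Omega) (x : KT) (r : branch Omega) : KT :=
  lext (fun T => << vee (edge a T) r >>) x.

(* The pair of families (fun g T => S ≺_g T, fun a T => S ≻_a T) attached to a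
   basis tree S. The formulas for S ≺_g T only use the products of the right
   subtree of S by T, and those for S ≻_a T the products of S by the left
   subtree of T: hence the inner recursion on T. The formulas themselves are
   the equations [tprec_leaf], ..., [tsucc_edge] below. *)
Fixpoint tprods (S : ptree Omega) :
    (Omega -> ptree Omega -> KT) * (Omega -> ptree Omega -> KT) :=
  let: vee l r := S in
  let pS := fun (g : Omega) (T : ptree Omega) =>
    match r with
    | leaf => << vee l (edge g T) >>
    | edge b S2 =>
        vee_linr l (b ← g) ((tprods S2).1 (b ◁ g) T)
        + vee_linr l (b → g) ((tprods S2).2 (b ▷ g) T)
    end in
  let sS := fix sS (a : Omega) (T : ptree Omega) {struct T} : KT :=
    let: vee l' r' := T in
    match l' with
    | leaf => << vee (edge a S) r' >>
    | edge b T1 =>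
        vee_linl (a → b) (sS (a ▷ b) T1) r'
        + vee_linl (a ← b) (pS (a ◁ b) T1) r'
    end in
  (pS, sS).

Definition tprec (a : Omega) (S T : ptree Omega) : KT := (tprods S).1 a T.
Definition tsucc (a : Omega) (S T : ptree Omega) : KT := (tprods S).2 a T.

Lemma tprec_leaf l g T : tprec g (vee l leaf) T = << vee l (edge g T) >>.
Proof. by []. Qed.

Lemma tprec_edge l b T2 g T :
  tprec g (vee l (edge b T2)) T =
  vee_linr l (b ← g) (tprec (b ◁ g) T2 T)
  + vee_linr l (b → g) (tsucc (b ▷ g) T2 T).
Proof. by []. Qed.

Lemma tsucc_leaf a T r : tsucc a T (vee leaf r) = << vee (edge a T) r >>.
Proof. by case: T. Qed.

Lemma tsucc_edge a T b T1 r :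
  tsucc a T (vee (edge b T1) r) =
  vee_linl (a → b) (tsucc (a ▷ b) T T1) r
  + vee_linl (a ← b) (tprec (a ◁ b) T T1) r.
Proof. by case: T. Qed.

Definition KTprec (a : Omega) : KT -> KT -> KT := bilext (tprec a).
Definition KTsucc (a : Omega) : KT -> KT -> KT := bilext (tsucc a).

End Algebras.

End OmegaStructures.

Arguments KTprec {Omega} larr rarr ltri rtri K a _ _.
Arguments KTsucc {Omega} larr rarr ltri rtri K a _ _.

(* Main.v *)
(* The middle dendriform relation holds for any four operations. The other two
   are proved for trees x and z by a nested induction: expanding the first one
   at x = l \/ T reduces it, through the EDS axioms, to all three relations at T,
   and expanding the third one at z = T \/ r reduces it to the three relations at
   (x, y, T). Freeness follows from T1 \/_{a, b} T2 = (T1 ≻_a Y) ≺_b T2, which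
   dictates the value of a morphism on every tree. Conversely, every EDS axiom
   can be read off from the first relation at (Y ≺_a Y, Y, Y). *)

Require Import Defs.
From mathcomp Require Import all_boot all_algebra finmap.
From mathcomp.classical Require Import boolp.
From mathcomp.multinomials Require Import monalg.

Set Implicit Arguments.
Unset Strict Implicit.
Unset Printing Implicit Defensive.

Import GRing.Theory.
Local Open Scope ring_scope.

(** * Linear and bilinear extension from a basis *)

Lemma linear_morphD (K : fieldType) (U V : lmodType K) (h : U -> V) :
  linear h -> {morph h : x y / x + y}.
Proof. by move=> hlin x y; have := hlin 1 x y; rewrite !scale1r. Qed.

Section LinearExtensionTheory.
Variables (K : fieldType) (T : choiceType) (V : lmodType K).
Implicit Types (f : T -> V) (g : T -> T -> V) (x y : {malg K[T]}).

Lemma malg_lincomb x : x = \sum_(t <- msupp x) x@_t *: << t >>.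
Proof.
rewrite {1}[x]monalgE; apply: eq_bigr => t _.
by apply/malgP=> u; rewrite mcoeffZ !mcoeffU mulrnAr mulr1.
Qed.

Lemma linear_lext (h : {malg K[T]} -> V) :
  linear h -> h =1 lext (fun t => h << t >>).
Proof.
move=> hlin x; rewrite {1}[x]malg_lincomb /lext.
(* Linearity at the scalar -1 and the zero vectors reads h 0 = - h 0 + h 0. *)
have h0 : h 0 = 0 by have := hlin (-1) 0 0; rewrite !scaleN1r oppr0 addr0 addNr.
elim: (enum_fset (msupp x)) => [|t s IHs]; first by rewrite !big_nil.
by rewrite !big_cons hlin IHs.
Qed.

(** Freedom in the index set puts [x], [y] and [c *: x + y] over one common set of trees. *)
Lemma lextEw f x (d : {fset T}) : (msupp x `<=` d)%fset ->
  lext f x = \sum_(t <- d) x@_t *: f t.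
Proof.
move=> le; rewrite /lext; apply: big_fset_incl => // t _ /mcoeff_outdom ->.
by rewrite scale0r.
Qed.

Lemma lext_linear f : linear (lext f).
Proof.
move=> c x y.
have le := fsubset_trans (msuppD_le (c *: x) y)
  (fsetUSS (msuppZ_le c x) (fsubset_refl _)).
rewrite (lextEw _ le) (lextEw _ (fsubsetUl (msupp x) (msupp y))).
rewrite (lextEw _ (fsubsetUr (msupp x) (msupp y))).
rewrite scaler_sumr -big_split; apply: eq_bigr => t _ /=.
by rewrite mcoeffD mcoeffZ scalerDl scalerA.
Qed.

Lemma eq_lext f1 f2 : f1 =1 f2 -> lext f1 =1 lext f2.
Proof. by move=> e x; apply: eq_bigr => t _; rewrite e. Qed.

(** The two orders of summation, here and in [bilextEr], give linearity in the first and in the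
    second argument. *)
Lemma bilextEl g x y : bilext g x y = lext (fun s => lext (g s) y) x.
Proof.
apply: eq_bigr => s _; rewrite scaler_sumr; apply: eq_bigr => t _.
by rewrite scalerA.
Qed.

Lemma bilextEr g x y : bilext g x y = lext (fun t => lext (g^~ t) x) y.
Proof.
rewrite /bilext exchange_big; apply: eq_bigr => t _.
rewrite scaler_sumr; apply: eq_bigr => s _.
by rewrite scalerA mulrC.
Qed.

Lemma bilext_linear_l g y : linear (bilext g ^~ y).
Proof. by move=> c u v; rewrite !bilextEl lext_linear. Qed.

Lemma bilext_linear_r g x : linear (bilext g x).
Proof. by move=> c u v; rewrite !bilextEr lext_linear. Qed.

Lemma linear_ext (h1 h2 : {malg K[T]} -> V) : linear h1 -> linear h2 ->
  (forall t, h1 << t >> = h2 << t >>) -> h1 =1 h2.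
Proof.
by move=> l1 l2 e x; rewrite (linear_lext l1) (linear_lext l2); apply: eq_lext.
Qed.

End LinearExtensionTheory.

(** * Typed trees: structural induction and shapes *)

Lemma ptree_subtree_ind (Omega : Type) (P : ptree Omega -> Prop) :
  (forall l r, (if l is edge _ T then P T else True) ->
    (if r is edge _ T then P T else True) -> P (vee l r)) ->
  forall T, P T.
Proof.
move=> step.
apply: (@ptree_branch_ind _ P (fun l => if l is edge _ T then P T else True)) => //.
by move=> l IHl r; apply: step.
Qed.

Lemma malgU_inj (K : fieldType) (T : choiceType) (s t : T) :
  << s >> = << t >> :> {malg K[T]} -> s = t.
Proof.
move/(congr1 (mcoeff t)); rewrite !mcoeffU eqxx; case: eqP => // _ /esym/eqP.
by rewrite mulr1n mulr0n oner_eq0.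
Qed.

(* Preorder code of the underlying untyped plane binary tree. *)
Fixpoint shape (Omega : Type) (T : ptree Omega) : seq bool :=
  let: vee l r := T in
  true :: (if l is edge _ T1 then shape T1 else [:: false])
       ++ (if r is edge _ T2 then shape T2 else [:: false]).

(** The projection onto the span of the trees of shape [s]. Being blind to types, it isolates terms
    of an identity before anything is known about their types. *)
Definition shape_part (Omega : Type) (K : fieldType) (s : seq bool) :
    {malg K[ptree Omega]} -> {malg K[ptree Omega]} :=
  lext (fun T => if shape T == s then << T >> else 0).

Lemma shape_part_add (Omega : Type) (K : fieldType) s :
  {morph @shape_part Omega K s : x y / x + y}.
Proof.
exact/linear_morphD/lext_linear.
Qed.

Lemma shape_partU (Omega : Type) (K : fieldType) s (T : ptree Omega) :
  shape_part s << T >> = (if shape T == s then << T >> else 0) :> {malg K[_]}.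
Proof. exact: lextU. Qed.

Definition shape_partE := (shape_part_add, shape_partU).

(** * The recursive formulas on linear combinations, and the middle relation *)

Section Products.
Variables (Omega : Type) (larr rarr ltri rtri : Omega -> Omega -> Omega).
Variable K : fieldType.

Local Infix "←" := larr (at level 40, left associativity).
Local Infix "→" := rarr (at level 40, left associativity).
Local Infix "◁" := ltri (at level 40, left associativity).
Local Infix "▷" := rtri (at level 40, left associativity).
Local Notation KT := {malg K[ptree Omega]}.
Local Notation prec := (KTprec larr rarr ltri rtri K).
Local Notation succ := (KTsucc larr rarr ltri rtri K).
Local Notation "x ≺[ a ] y" := (prec a x y) (at level 40, y at next level).
Local Notation "x ≻[ a ] y" := (succ a x y) (at level 40, y at next level).
Implicit Types (a b c g : Omega) (l r : branch Omega) (x y z : KT).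

(** In the middle relation both branches become combinations at once, beyond the reach of [vee_linl]
    and [vee_linr]. *)
Definition vee_lin2 a b : KT -> KT -> KT :=
  bilext (fun S T => << vee (edge a S) (edge b T) >>).

Lemma vee_linrU l b T : vee_linr l b << T >> = << vee l (edge b T) >> :> KT.
Proof. exact: lextU. Qed.

Lemma vee_linlU a T r : vee_linl a << T >> r = << vee (edge a T) r >> :> KT.
Proof. exact: lextU. Qed.

Lemma vee_linr_linear l b : linear (@vee_linr Omega K l b).
Proof. exact: lext_linear. Qed.

Lemma vee_linl_linear a r : linear (fun x : KT => vee_linl a x r).
Proof. exact: lext_linear. Qed.

Lemma prec_linl g z : linear (fun x => x ≺[g] z).
Proof. exact: bilext_linear_l. Qed.

Lemma prec_linr g x : linear (fun z => x ≺[g] z).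
Proof. exact: bilext_linear_r. Qed.

Lemma succ_linl g z : linear (fun x => x ≻[g] z).
Proof. exact: bilext_linear_l. Qed.

Lemma succ_linr g x : linear (fun z => x ≻[g] z).
Proof. exact: bilext_linear_r. Qed.

Lemma vee_lin2_linl a b z : linear (fun x => vee_lin2 a b x z).
Proof. exact: bilext_linear_l. Qed.

Lemma vee_lin2_linr a b x : linear (vee_lin2 a b x).
Proof. exact: bilext_linear_r. Qed.

Definition linE := (prec_linl, prec_linr, succ_linl, succ_linr,
  vee_lin2_linl, vee_lin2_linr, vee_linr_linear, vee_linl_linear).

(** For the linearity goals of [linear_ext]; [addrACA] regroups a sum of two linear maps. *)
Ltac solve_linear := let c := fresh in let u := fresh in let v := fresh in
  by move=> c u v; cbv beta; rewrite !linE ?scalerDr 1?addrACA.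

Lemma prec_addl g z : {morph (fun x => x ≺[g] z) : x y / x + y}.
Proof. exact/linear_morphD/prec_linl. Qed.

Lemma prec_addr g x : {morph (fun z => x ≺[g] z) : y z / y + z}.
Proof. exact/linear_morphD/prec_linr. Qed.

Lemma succ_addl g z : {morph (fun x => x ≻[g] z) : x y / x + y}.
Proof. exact/linear_morphD/succ_linl. Qed.

Lemma succ_addr g x : {morph (fun z => x ≻[g] z) : y z / y + z}.
Proof. exact/linear_morphD/succ_linr. Qed.

Lemma vee_linr_add l b : {morph @vee_linr Omega K l b : x y / x + y}.
Proof. exact/linear_morphD/vee_linr_linear. Qed.

Lemma vee_linl_add a r : {morph (fun x : KT => vee_linl a x r) : x y / x + y}.
Proof. exact/linear_morphD/vee_linl_linear. Qed.

Definition addE := (prec_addl, prec_addr, succ_addl, succ_addr,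
  vee_linr_add, vee_linl_add).

Lemma prec_vee_leaf g l z : << vee l leaf >> ≺[g] z = vee_linr l g z.
Proof.
move: z; apply: linear_ext => [||T]; try solve_linear.
by rewrite vee_linrU [LHS]bilextU tprec_leaf.
Qed.

Lemma prec_vee_linr g l b x z :
  vee_linr l b x ≺[g] z =
  vee_linr l (b ← g) (x ≺[b ◁ g] z) + vee_linr l (b → g) (x ≻[b ▷ g] z).
Proof.
move: x; apply: linear_ext => [||S]; try solve_linear.
move: z; apply: linear_ext => [||T]; try solve_linear.
by rewrite vee_linrU [LHS]bilextU tprec_edge /KTprec /KTsucc !bilextU.
Qed.

Lemma succ_vee_leaf a x r : x ≻[a] << vee leaf r >> = vee_linl a x r.
Proof.
move: x; apply: linear_ext => [||S]; try solve_linear.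
by rewrite vee_linlU [LHS]bilextU tsucc_leaf.
Qed.

Lemma succ_vee_linl a x b z r :
  x ≻[a] vee_linl b z r =
  vee_linl (a → b) (x ≻[a ▷ b] z) r + vee_linl (a ← b) (x ≺[a ◁ b] z) r.
Proof.
move: x; apply: linear_ext => [||S]; try solve_linear.
move: z; apply: linear_ext => [||T]; try solve_linear.
by rewrite vee_linlU [LHS]bilextU tsucc_edge /KTprec /KTsucc !bilextU.
Qed.

Lemma vee_lin2Ul a S b z : vee_lin2 a b << S >> z = vee_linr (edge a S) b z.
Proof.
move: z; apply: linear_ext => [||T]; try solve_linear.
by rewrite vee_linrU [LHS]bilextU.
Qed.

Lemma vee_lin2Ur a x b T : vee_lin2 a b x << T >> = vee_linl a x (edge b T).
Proof.
move: x; apply: linear_ext => [||S]; try solve_linear.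
by rewrite vee_linlU [LHS]bilextU.
Qed.

Lemma prec_vee_lin2 g a b x y z :
  vee_lin2 a b x y ≺[g] z =
  vee_lin2 a (b ← g) x (y ≺[b ◁ g] z) + vee_lin2 a (b → g) x (y ≻[b ▷ g] z).
Proof.
move: x; apply: linear_ext => [||S]; try solve_linear.
by rewrite !vee_lin2Ul prec_vee_linr.
Qed.

Lemma succ_vee_lin2 g a b x y z :
  x ≻[g] vee_lin2 a b y z =
  vee_lin2 (g → a) b (x ≻[g ▷ a] y) z + vee_lin2 (g ← a) b (x ≺[g ◁ a] y) z.
Proof.
move: z; apply: linear_ext => [||S]; try solve_linear.
by rewrite !vee_lin2Ur succ_vee_linl.
Qed.

Lemma prec_vee_linl_leaf g a x z : vee_linl a x leaf ≺[g] z = vee_lin2 a g x z.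
Proof.
move: x; apply: linear_ext => [||S]; try solve_linear.
by rewrite vee_linlU prec_vee_leaf vee_lin2Ul.
Qed.

Lemma succ_vee_linr_leaf g b x z : x ≻[g] vee_linr leaf b z = vee_lin2 g b x z.
Proof.
move: z; apply: linear_ext => [||S]; try solve_linear.
by rewrite vee_linrU succ_vee_leaf vee_lin2Ur.
Qed.

(** Multiplying by [x] on the left alters only the left branch of [y], multiplying by [z] on the
    right only its right branch, so the two operations commute. The cases record which branches of
    [y] are trivial. *)
Lemma KT_dend_mid a b x y z : x ≻[a] (y ≺[b] z) = (x ≻[a] y) ≺[b] z.
Proof.
move: y; apply: linear_ext => [||[[|c S] [|d T]]]; try solve_linear.
- by rewrite prec_vee_leaf succ_vee_leaf succ_vee_linr_leaf prec_vee_linl_leaf.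
- rewrite -[in LHS]vee_linrU prec_vee_linr succ_addr !succ_vee_linr_leaf.
  by rewrite succ_vee_leaf -vee_lin2Ur prec_vee_lin2.
- rewrite -[in RHS]vee_linlU prec_vee_leaf succ_vee_linl prec_addl.
  by rewrite !prec_vee_linl_leaf -vee_lin2Ul succ_vee_lin2.
- rewrite -vee_linlU -vee_lin2Ur prec_vee_lin2 !succ_vee_lin2.
  by rewrite succ_addr prec_addl !succ_vee_lin2 !prec_vee_lin2 addrACA.
Qed.

(** * From the EDS axioms to the dendriform relations *)

Section EDSToDendriform.
Hypothesis eds : is_EDS larr rarr ltri rtri.
Let dia := eds_diassociative eds.

(** The two relations are joined because the first one at [S] needs both at the right subtree of
    [S]. *)
Lemma KT_dend_prec_succ S :
  (forall a b y z, (<< S >> ≺[a] y) ≺[b] z =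
     << S >> ≺[a ← b] (y ≺[a ◁ b] z) + << S >> ≺[a → b] (y ≻[a ▷ b] z)) /\
  (forall a b y z, << S >> ≻[a] (y ≻[b] z) =
     (<< S >> ≻[a ▷ b] y) ≻[a → b] z + (<< S >> ≺[a ◁ b] y) ≻[a ← b] z).
Proof.
elim/ptree_subtree_ind: S => l r _ IHr.
set S := vee l r.
have dprec a b y z : (<< S >> ≺[a] y) ≺[b] z =
    << S >> ≺[a ← b] (y ≺[a ◁ b] z) + << S >> ≺[a → b] (y ≻[a ▷ b] z).
  rewrite {}/S; case: r IHr => [_|c T [IHp IHs]].
    by rewrite !prec_vee_leaf prec_vee_linr.
  rewrite -!vee_linrU !prec_vee_linr prec_addl !prec_vee_linr.
  rewrite IHp IHs KT_dend_mid !vee_linr_add.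
  (* Each side is now a sum of five terms grafted on [l]: T ≺ (y ≺ z), T ≺ (y ≻ z), (T ≺ y) ≻ z, (T
     ≻ y) ≺ z and (T ≻ y) ≻ z. The ten EDS axioms match the types inside these products, the
     diassociative ones the type of the root edge. *)
  rewrite (eds_l_larr eds) (eds_l_ltri eds) (eds_l_rarr eds) (eds_l_rtri eds).
  rewrite (eds_r_larr eds) (eds_r_ltri eds) (eds_r_rarr eds) (eds_r_rtri eds).
  rewrite (eds_rtri_larr eds) (eds_rarr_ltri eds).
  rewrite -(dia_ll_r dia) (dia_ll_l dia) (dia_rl dia) -(dia_rr_r dia).
  rewrite -(dia_rr_l dia).
  by rewrite [RHS](AC (2*(1*2))%AC (1*3*5*(2*4))%AC).
split=> // a b y z; move: z a b y.
suff dsucc T a b y : << S >> ≻[a] (y ≻[b] << T >>) =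
    (<< S >> ≻[a ▷ b] y) ≻[a → b] << T >> + (<< S >> ≺[a ◁ b] y) ≻[a ← b] << T >>.
  by move=> z a b y; move: z; apply: linear_ext; try solve_linear.
elim/ptree_subtree_ind: T a b y => l' r' IHl _ a b y.
case: l' IHl => [_|c T IH].
  by rewrite !succ_vee_leaf succ_vee_linl.
rewrite -!vee_linlU !succ_vee_linl succ_addr !succ_vee_linl.
(* The term (S ≺ y) ≺ T calls for the first relation at [S] itself, which is why [dprec] comes
   first. *)
rewrite dprec IH KT_dend_mid !vee_linl_add.
rewrite (eds_l_larr eds) (eds_l_ltri eds) (eds_l_rarr eds) (eds_l_rtri eds).
rewrite (eds_r_larr eds) (eds_r_ltri eds) (eds_r_rarr eds) (eds_r_rtri eds).
rewrite (eds_rtri_larr eds) (eds_rarr_ltri eds).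
rewrite -(dia_ll_r dia) (dia_ll_l dia) (dia_rl dia) -(dia_rr_r dia).
rewrite -(dia_rr_l dia).
by rewrite [RHS](AC (2*(1*2))%AC (1*3*5*(2*4))%AC).
Qed.

Lemma KT_dendriform : is_dendriform larr rarr ltri rtri prec succ.
Proof.
split.
- exact: prec_linl.
- exact: prec_linr.
- exact: succ_linl.
- exact: succ_linr.
- move=> a b x y z; move: x; apply: linear_ext => [||S]; try solve_linear.
  by rewrite (KT_dend_prec_succ S).1.
- exact: KT_dend_mid.
- move=> a b x y z; move: x; apply: linear_ext => [||S]; try solve_linear.
  by rewrite (KT_dend_prec_succ S).2.
Qed.

End EDSToDendriform.

(** * The universal property *)

Section Universal.
Variables (B : lmodType K) (precB succB : Omega -> B -> B -> B).
Hypothesis dendB : is_dendriform larr rarr ltri rtri precB succB.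
Variable b0 : B.

Fixpoint tree_eval (T : ptree Omega) : B :=
  let: vee l r := T in
  let x := if l is edge a T1 then succB a (tree_eval T1) b0 else b0 in
  if r is edge c T2 then precB c x (tree_eval T2) else x.

(** [tree_eval] grafts on the left first; the other bracketing, wanted when ≻ recurses through a
    left branch, is the middle relation of [B]. *)
Lemma tree_eval_edgel a T r :
  tree_eval (vee (edge a T) r) = succB a (tree_eval T) (tree_eval (vee leaf r)).
Proof. by case: r => [|d S] //=; rewrite (dend_mid dendB). Qed.

Definition mor_eval : KT -> B := lext tree_eval.

Lemma mor_evalU T : mor_eval << T >> = tree_eval T.
Proof. exact: lextU. Qed.

Lemma mor_eval_linear : linear mor_eval.
Proof. exact: lext_linear. Qed.

Lemma mor_evalD : {morph mor_eval : x y / x + y}.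
Proof. exact/linear_morphD/mor_eval_linear. Qed.

Lemma mor_eval_vee_linr l c x :
  mor_eval (vee_linr l c x) = precB c (tree_eval (vee l leaf)) (mor_eval x).
Proof.
move: x; apply: linear_ext => [||T].
- by move=> k u v; rewrite vee_linr_linear mor_eval_linear.
- by move=> k u v; rewrite mor_eval_linear (prec_linear_r dendB).
by rewrite vee_linrU !mor_evalU.
Qed.

Lemma mor_eval_vee_linl c x r :
  mor_eval (vee_linl c x r) = succB c (mor_eval x) (tree_eval (vee leaf r)).
Proof.
move: x; apply: linear_ext => [||T].
- by move=> k u v; rewrite vee_linl_linear mor_eval_linear.
- by move=> k u v; rewrite mor_eval_linear (succ_linear_l dendB).
by rewrite vee_linlU !mor_evalU tree_eval_edgel.
Qed.

(** The nested induction of the relations again: the recursive formulas produce the two-term sides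
    of the axioms of [B], which are then folded back. *)
Lemma mor_eval_tree S :
  (forall g T, mor_eval (<< S >> ≺[g] << T >>) = precB g (tree_eval S) (tree_eval T)) /\
  (forall g T, mor_eval (<< S >> ≻[g] << T >>) = succB g (tree_eval S) (tree_eval T)).
Proof.
elim/ptree_subtree_ind: S => l r _ IHr.
set S := vee l r.
have mprec g T :
    mor_eval (<< S >> ≺[g] << T >>) = precB g (tree_eval S) (tree_eval T).
  rewrite {}/S; case: r IHr => [_|b S [IHp IHs]].
    by rewrite prec_vee_leaf mor_eval_vee_linr mor_evalU.
  rewrite -vee_linrU prec_vee_linr mor_evalD !mor_eval_vee_linr IHp IHs.
  by rewrite -(dend_prec dendB).
split=> // g T; elim/ptree_subtree_ind: T g => l' r' IHl _ g.
case: l' IHl => [_|b T IH].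
  by rewrite succ_vee_leaf mor_eval_vee_linl mor_evalU.
rewrite -vee_linlU succ_vee_linl mor_evalD !mor_eval_vee_linl IH mprec.
by rewrite -(dend_succ dendB) [in RHS]tree_eval_edgel.
Qed.

Lemma mor_eval_morphism : is_dend_morphism prec succ precB succB mor_eval.
Proof.
split=> [|a x y|a x y]; first exact: mor_eval_linear.
- move: x; apply: linear_ext => [||S].
  + by move=> k u v; rewrite prec_linl mor_eval_linear.
  + by move=> k u v; rewrite mor_eval_linear (prec_linear_l dendB).
  move: y; apply: linear_ext => [||T].
  + by move=> k u v; rewrite prec_linr mor_eval_linear.
  + by move=> k u v; rewrite mor_eval_linear (prec_linear_r dendB).
  by rewrite (mor_eval_tree S).1 !mor_evalU.
- move: x; apply: linear_ext => [||S].
  + by move=> k u v; rewrite succ_linl mor_eval_linear.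
  + by move=> k u v; rewrite mor_eval_linear (succ_linear_l dendB).
  move: y; apply: linear_ext => [||T].
  + by move=> k u v; rewrite succ_linr mor_eval_linear.
  + by move=> k u v; rewrite mor_eval_linear (succ_linear_r dendB).
  by rewrite (mor_eval_tree S).2 !mor_evalU.
Qed.

Lemma mor_eval_uniq f : is_dend_morphism prec succ precB succB f ->
  f << treeY >> = b0 -> f =1 mor_eval.
Proof.
move=> [flin fprec fsucc] fY.
apply: linear_ext (flin) mor_eval_linear _ => T; rewrite mor_evalU.
(* Trees with trivial right branch come first: they are Y or T1 ≻ Y, and every other tree is one of
   them ≺ T2. *)
have f_leaf l : (if l is edge _ T1 then f << T1 >> = tree_eval T1 else True) ->
    f << vee l leaf >> = tree_eval (vee l leaf).
  case: l => [|a S] /= IH; first exact: fY.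
  by rewrite -vee_linlU -succ_vee_leaf fsucc fY IH.
elim/ptree_subtree_ind: T => l [|c T] IHl IHr; first exact: f_leaf.
by rewrite -vee_linrU -prec_vee_leaf fprec f_leaf // IHr.
Qed.

End Universal.

Lemma KT_free : is_EDS larr rarr ltri rtri ->
  is_free_dendriform_on larr rarr ltri rtri prec succ << treeY >>.
Proof.
move=> eds; split; first exact: KT_dendriform.
move=> B precB succB dendB b; exists (mor_eval precB succB b); split.
  by split; [exact: mor_eval_morphism | rewrite mor_evalU].
by move=> f [fmor fY]; apply/funext=> x; rewrite (mor_eval_uniq fmor fY).
Qed.

(** * From the dendriform relations back to the EDS axioms *)

(* The first dendriform relation at (Y ≺_a Y, Y, Y). The right subtrees on each
   side run once through the five plane binary trees with three vertices, so
   terms of equal shape must agree. *)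
Lemma prec_comb_expand a b c :
  let Y := treeY in
  let R d T := vee leaf (edge d T) in
  let L d T := vee (edge d T) leaf in
  is_dendriform larr rarr ltri rtri prec succ ->
  << R ((a ← b) ← c) (R ((a ◁ b) ← ((a ← b) ◁ c))
       (R ((a ◁ b) ◁ ((a ← b) ◁ c)) Y)) >> +
  << R ((a ← b) ← c) (R ((a ◁ b) → ((a ← b) ◁ c))
       (L ((a ◁ b) ▷ ((a ← b) ◁ c)) Y)) >> +
  << R ((a ← b) → c) (L ((a ← b) ▷ c) (R (a ◁ b) Y)) >> +
  (<< R ((a → b) ← c) (vee (edge (a ▷ b) Y) (edge ((a → b) ◁ c) Y)) >> +
   << R ((a → b) → c) (L ((a → b) ▷ c) (L (a ▷ b) Y)) >>) =
  << R (a ← (b ← c)) (R (a ◁ (b ← c)) (R (b ◁ c) Y)) >> +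
  << R (a → (b ← c)) (vee (edge (a ▷ (b ← c)) Y) (edge (b ◁ c) Y)) >> +
  (<< R (a ← (b → c)) (R (a ◁ (b → c)) (L (b ▷ c) Y)) >> +
   (<< R (a → (b → c)) (L ((a ▷ (b → c)) → (b ▷ c))
         (L ((a ▷ (b → c)) ▷ (b ▷ c)) Y)) >> +
    << R (a → (b → c)) (L ((a ▷ (b → c)) ← (b ▷ c))
         (R ((a ▷ (b → c)) ◁ (b ▷ c)) Y)) >>)) :> KT.
Proof.
move=> Y R L dend.
have := dend_prec dend b c << R a Y >> << Y >> << Y >>.
pose stepE := (prec_vee_linr, prec_vee_leaf, succ_vee_leaf, succ_vee_linl, addE).
rewrite /R /L /Y /treeY -!vee_linrU !(stepE, vee_linrU, vee_linlU).
(* Refolding the basis trees exposes any product left by the first pass to the recursive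
   formulas. *)
by rewrite -?(vee_linrU, vee_linlU) !(stepE, vee_linrU, vee_linlU).
Qed.

(** Each of the five shapes occurs once on either side of [prec_comb_expand], so projecting on it
    equates two single trees, hence their three types. *)
Lemma KT_dendriform_EDS :
  is_dendriform larr rarr ltri rtri prec succ -> is_EDS larr rarr ltri rtri.
Proof.
move=> dend.
pose R d (T : ptree Omega) := vee leaf (edge d T).
pose L d (T : ptree Omega) := vee (edge d T) leaf.
have part s a b c := congr1 (shape_part s) (prec_comb_expand a b c dend).
have eRRR a b c : [/\ (a ← b) ← c = a ← (b ← c),
    (a ◁ b) ← ((a ← b) ◁ c) = a ◁ (b ← c) &
    (a ◁ b) ◁ ((a ← b) ◁ c) = b ◁ c].
  (* Only the shape of this tree matters; the types [a] are placeholders. *)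
  have := part (shape (R a (R a (R a treeY)))) a b c.
  by rewrite !shape_partE /= !(addr0, add0r) => /malgU_inj [].
have eRRL a b c : [/\ (a ← b) ← c = a ← (b → c),
    (a ◁ b) → ((a ← b) ◁ c) = a ◁ (b → c) &
    (a ◁ b) ▷ ((a ← b) ◁ c) = b ▷ c].
  have := part (shape (R a (R a (L a treeY)))) a b c.
  by rewrite !shape_partE /= !(addr0, add0r) => /malgU_inj [].
have eRLR a b c : [/\ (a ← b) → c = a → (b → c),
    (a ← b) ▷ c = (a ▷ (b → c)) ← (b ▷ c) &
    a ◁ b = (a ▷ (b → c)) ◁ (b ▷ c)].
  have := part (shape (R a (L a (R a treeY)))) a b c.
  by rewrite !shape_partE /= !(addr0, add0r) => /malgU_inj [].
have eRLL a b c : [/\ (a → b) → c = a → (b → c),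
    (a → b) ▷ c = (a ▷ (b → c)) → (b ▷ c) &
    a ▷ b = (a ▷ (b → c)) ▷ (b ▷ c)].
  have := part (shape (R a (L a (L a treeY)))) a b c.
  by rewrite !shape_partE /= !(addr0, add0r) => /malgU_inj [].
have eRV a b c : [/\ (a → b) ← c = a → (b ← c),
    a ▷ b = a ▷ (b ← c) & (a → b) ◁ c = b ◁ c].
  have := part (shape (R a (vee (edge a treeY) (edge a treeY)))) a b c.
  by rewrite !shape_partE /= !(addr0, add0r) => /malgU_inj [].
split=> [|a b c|a b c|a b c|a b c|a b c|a b c|a b c|a b c|a b c|a b c].
- split=> a b c.
  + by case: (eRRR a b c).
  (* Two shapes share the root type (a ← b) ← c on the left side; two others share a → (b → c) on
     the right, which gives [dia_rr_l] below. *)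
  + by case: (eRRR a b c) (eRRL a b c) => <- _ _ [->].
  + by case: (eRV a b c).
  + by case: (eRLR a b c) (eRLL a b c) => -> _ _ [->].
  + by case: (eRLR a b c).
- by case: (eRV a b c).
- by case: (eRV a b c).
- by case: (eRRR a b c).
- by case: (eRRR a b c).
- by case: (eRRL a b c).
- by case: (eRRL a b c).
- by case: (eRLR a b c).
- by case: (eRLR a b c).
- by case: (eRLL a b c).
- by case: (eRLL a b c).
Qed.

End Products.

Theorem proposition15 (K : fieldType) (Omega : Type)
    (larr rarr ltri rtri : Omega -> Omega -> Omega) :
  let prec := KTprec larr rarr ltri rtri K in
  let succ := KTsucc larr rarr ltri rtri K in
  [<-> is_free_dendriform_on larr rarr ltri rtri prec succ
         << treeY >>%R;
       is_dendriform larr rarr ltri rtri prec succ;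
       is_EDS larr rarr ltri rtri].
Proof.
move=> prec succ; tfae; first by case.
- exact: KT_dendriform_EDS.
- exact: KT_free.
Qed.
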